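(* Let $n\ge 2$, let $\theta_1,\dots,\theta_n\in[-\pi,\pi]$, $\Theta=\sum_{j=1}^n\theta_j$, and let $$\tau_1=1,\qquad \tau_j=e^{i\theta_j}\ (2\le j\le n),\qquad \tau_j=e^{i(\Theta-\theta_{2n-j+1})}\ (n+1\le j\le 2n-1),\qquad \tau_{2n}=e^{i\Theta}.$$ Consider the $n$-cubic quantum graph with edge lengths $a_1,\dots,a_n>0$ and real-valued potentials $q_1,\dots,q_{2n}$ on the $2n$ edges of the fundamental domain, and let $\Phi(\rho)$ be its characteristic function and $C_j,S_j,C_j',S_j'$ the associated boundary values (see context). (a) The characteristic function is $$\Phi(\rho)=-\Big(\sum_{k=1}^{2n}\tau_kC_k'\Big)\sum_{l=1}^{2n}\Big(\prod_{i\ne l}\tau_iS_i\Big)+\sum_{l=2}^{2n}\Big((C_1-\tau_lC_l)\sum_{\substack{1\le k\le 2n\\ k\neq l}}\Big(\prod_{i\neq l,k}\tau_iS_i\Big)(\tau_kS_k'-\tau_lS_l')\Big),$$ where the products run over $i\in\{1,\dots,2n\}$ with the indicated indices omitted. (b) If all the edge lengths $a_i$ are equal to $a$, and the potentials $q_i$ are all identical to one function $q$ which is even on $(0,a)$ (i.e. $q(a-x)=q(x)$), then $C_j=C$ and $S_j=S$ for all $j$, where $C=C(a,\rho)$, $S=S(a,\rho)$, and $$\Phi(\rho)=4e^{in\Theta}S^{2n-2}\left\{\left[\cos\Big(\frac{\Theta}{2}\Big)+\sum_{l=2}^n\cos\Big(\frac{\Theta-2\theta_l}{2}\Big)\right]^2-n^2(S')^2\right\}.$$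 Thus $\rho$ is a singular value if and only if $$S(a,\rho)=0\quad\text{or}\quad S'(a,\rho)=\pm\frac1n\left(\cos\Big(\frac{\Theta}{2}\Big)+\sum_{l=2}^n\cos\Big(\frac{\Theta-2\theta_l}{2}\Big)\right).$$
   Context: Setting. The fundamental domain of the $n$-cubic graph (the grid graph in $\mathbb{R}^n$ with edges of length $a_j$ in the $j$-th coordinate direction) consists of the $2n$ edges issuing from the origin. Edge $j$ has length $\ell_j$, where $\ell_j=a_j$ for $1\le j\le n$ and $\ell_j=a_{2n-j+1}$ for $n+1\le j\le 2n$, and is identified with $[0,\ell_j]$ with $x=0$ at the origin; $q_j\in L^2(0,\ell_j)$. The Floquet-Bloch conditions with quasi-momentum $(\theta_1,\dots,\theta_n)$ together with the Neumann (continuity-Kirchhoff) vertex conditions give the following problem for $(y_1,\dots,y_{2n})$, with $\tau_j$ as in the claim and $\lambda=\rho^2$: $-y_j''+q_jy_j=\lambda y_j$ on $(0,\ell_j)$, $$y_1(0)=y_2(0)=\dots=y_{2n}(0),\qquad \sum_{j=1}^{2n}y_j'(0)=0,$$ $$y_1(\ell_1)=\tau_jy_j(\ell_j)\quad(j=2,\dots,2n),\qquad \sum_{j=1}^{2n}\tau_jy_j'(\ell_j)=0.$$ Notation. $C_j(x,\rho)$ and $S_j(x,\rho)$ are the solutions of $-y''+q_jy=\lambda y$ on $[0,\ell_j]$ with $C_j(0,\rho)=S_j'(0,\rho)=1$, $C_j'(0,\rho)=S_j(0,\rho)=0$ (prime is $d/dx$). Write $C_j=C_j(\ell_j,\rho)$,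 $S_j=S_j(\ell_j,\rho)$, $C_j'=C_j'(\ell_j,\rho)$, $S_j'=S_j'(\ell_j,\rho)$. When all potentials equal $q$ and all lengths equal $a$, the subscripts are dropped, and $S'=S'(a,\rho)$. Characteristic function. Writing $y_j=A\,C_j(x,\rho)+B_jS_j(x,\rho)$, with common value $A=y_j(0)$, the problem becomes a homogeneous linear system in $(A,B_1,\dots,B_{2n})$, and $\Phi(\rho)$ is its $(2n+1)\times(2n+1)$ determinant, with rows $$(0,1,1,\dots,1);$$ for $l=2,\dots,2n$ (in this order), the row whose first entry is $C_1-\tau_lC_l$, whose second entry (column of $B_1$) is $S_1$, whose entry in the column of $B_l$ is $-\tau_lS_l$, and whose other entries are $0$; and last $$\Big(\sum_{k=1}^{2n}\tau_kC_k',\ S_1',\ \tau_2S_2',\ \dots,\ \tau_{2n}S_{2n}'\Big).$$ A number $\rho$ is called a singular value (for the given $\theta_1,\dots,\theta_n$) if $\Phi(\rho)=0$, i.e. if, for $\lambda=\rho^2$, there is a nontrivial $(y_1,\dots,y_{2n})$ satisfying $-y_j''+q_jy_j=\lambda y_j$ on $(0,\ell_j)$ for $j=1,\dots,2n$, together with $y_1(0)=y_2(0)=\dots=y_{2n}(0)$, $\sum_{j=1}^{2n}y_j'(0)=0$, $y_1(\ell_1)=\tau_jy_j(\ell_j)$ for $j=2,\dots,2n$, and $\sum_{j=1}^{2n}\tau_jy_j'(\ell_j)=0$. *)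

(* Defs.v *)
From HB Require Import structures.
From mathcomp Require Import all_boot all_order all_algebra.
From mathcomp Require Import complex.
From mathcomp Require Import all_classical all_reals all_analysis.

Set Implicit Arguments.
Unset Strict Implicit.
Unset Printing Implicit Defensive.

Import Order.TTheory GRing.Theory Num.Theory.
Import numFieldNormedType.Exports.

Local Open Scope classical_set_scope.
Local Open Scope ring_scope.
Local Open Scope complex_scope.

(* Families indexed by the edges 1, ..., 2n (or by the directions 1, ..., n)
   are functions on nat; values outside the index range are never used. *)

Definition expi (R : realType) (t : R) : R[i] := cos t +i* sin t.

Definition cintegrable (R : realType) (D : set R) (g : R -> R[i]) : Prop :=
  (@lebesgue_measure R).-integrable D (EFin \o (@complex.Re R \o g)) /\
  (@lebesgue_measure R).-integrable D (EFin \o (@complex.Im R \o g)).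

Definition cintegral (R : realType) (D : set R) (g : R -> R[i]) : R[i] :=
  Rintegral (@lebesgue_measure R) D (@complex.Re R \o g) +i*
  Rintegral (@lebesgue_measure R) D (@complex.Im R \o g).

(* f is absolutely continuous on [0, l], with almost everywhere derivative g,
   i.e. f is an indefinite integral of the integrable function g. *)
Definition ac_deriv (R : realType) (l : R) (f g : R -> R[i]) : Prop :=
  cintegrable `]0, l[ g /\
  forall x : R, 0 <= x <= l -> f x = f 0 + cintegral `]0, x[ g.

(* Functions on (0, l) are represented by functions on the whole line whose
   values outside (0, l) are disregarded. *)
Definition potential (R : realType) (l : R) (q : R -> R) : Prop :=
  (q \_ `]0, l[) \in Lfun (@lebesgue_measure R) 2%:E.

(* y solves - y'' + q y = lambda y on (0, l) and dy = y' on [0, l].  As q is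
   only square integrable, y and y' are absolutely continuous on [0, l] and
   the equation holds almost everywhere. *)
Definition sl_solution (R : realType) (q : R -> R) (l : R) (lambda : R[i])
    (y dy : R -> R[i]) : Prop :=
  ac_deriv l y dy /\
  exists d2y : R -> R[i], ac_deriv l dy d2y /\
    {ae (@lebesgue_measure R), forall x, x \in `]0, l[ ->
       - d2y x + (q x)%:C * y x = lambda * y x}.

(* C(x, rho), S(x, rho) and their x-derivatives dC, dS. *)
Definition fundamental_solutions (R : realType) (q : R -> R) (l : R)
    (C dC S dS : R -> R[i] -> R[i]) : Prop :=
  forall rho : R[i],
  [/\ sl_solution q l (rho ^+ 2) (C ^~ rho) (dC ^~ rho),
      sl_solution q l (rho ^+ 2) (S ^~ rho) (dS ^~ rho),
      C 0 rho = 1 /\ dC 0 rho = 0 &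
      S 0 rho = 0 /\ dS 0 rho = 1].

Definition edge_length (R : realType) (n : nat) (a : nat -> R) (j : nat) : R :=
  if (j <= n)%N then a j else a (2 * n - j).+1.

Definition theta_sum (R : realType) (n : nat) (theta : nat -> R) : R :=
  \sum_(1 <= j < n.+1) theta j.

Definition tau (R : realType) (n : nat) (theta : nat -> R) (j : nat) : R[i] :=
  if j == 1%N then 1
  else if (j <= n)%N then expi (theta j)
  else if (j <= (2 * n).-1)%N then
    expi (theta_sum n theta - theta (2 * n - j).+1)
  else expi (theta_sum n theta).

(* Rows and columns are numbered from 0: column 0 is that of A and column c > 0
   that of B_c, so row r with 0 < r < 2n is the row l = r + 1 of the system. *)
Definition system_matrix (R : realType) (n : nat) (t c s dc ds : nat -> R[i]) :
    'M[R[i]]_((2 * n).+1) :=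
  \matrix_(i, j)
    let r := nat_of_ord i in let k := nat_of_ord j in
    if r == 0%N then (if k == 0%N then 0 else 1)
    else if r == (2 * n)%N then
      if k == 0%N then \sum_(1 <= m < (2 * n).+1) t m * dc m
      else if k == 1%N then ds 1%N
      else t k * ds k
    else
      let l := r.+1 in
      if k == 0%N then c 1%N - t l * c l
      else if k == 1%N then s 1%N
      else if k == l then - (t l * s l)
      else 0.

Definition Phi (R : realType) (n : nat) (theta a : nat -> R)
    (Cj dCj Sj dSj : nat -> R -> R[i] -> R[i]) (rho : R[i]) : R[i] :=
  let l := edge_length n a in
  \det (system_matrix n (tau n theta)
    (fun j => Cj j (l j) rho) (fun j => Sj j (l j) rho)
    (fun j => dCj j (l j) rho) (fun j => dSj j (l j) rho)).

Definition singular_value (R : realType) (n : nat) (theta a : nat -> R)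
    (Cj dCj Sj dSj : nat -> R -> R[i] -> R[i]) (rho : R[i]) : Prop :=
  Phi n theta a Cj dCj Sj dSj rho = 0.

Definition has_nontrivial_solution (R : realType) (n : nat)
    (theta a : nat -> R) (q : nat -> R -> R) (rho : R[i]) : Prop :=
  let l := edge_length n a in
  let t := tau n theta in
  exists y dy : nat -> R -> R[i],
  [/\ forall j, (1 <= j <= 2 * n)%N ->
        sl_solution (q j) (l j) (rho ^+ 2) (y j) (dy j),
      exists (j : nat) (x : R), [/\ (1 <= j <= 2 * n)%N, 0 <= x <= l j & y j x != 0],
      (forall j, (2 <= j <= 2 * n)%N -> y 1%N 0 = y j 0) /\
        \sum_(1 <= j < (2 * n).+1) dy j 0 = 0 &
      (forall j, (2 <= j <= 2 * n)%N -> y 1%N (l 1%N) = t j * y j (l j)) /\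
        \sum_(1 <= j < (2 * n).+1) t j * dy j (l j) = 0].

Definition cos_sum (R : realType) (n : nat) (theta : nat -> R) : R :=
  cos (theta_sum n theta / 2) +
  \sum_(2 <= l < n.+1) cos ((theta_sum n theta - 2 * theta l) / 2).

(* Main.v *)
Require Import Defs.
From HB Require Import structures.
From mathcomp Require Import all_boot all_order all_algebra.
From mathcomp Require Import perm complex.
From mathcomp Require Import all_classical all_reals all_analysis.
From mathcomp Require Import ring lra zify.

Set Implicit Arguments.
Unset Strict Implicit.
Unset Printing Implicit Defensive.

Import Order.TTheory GRing.Theory Num.Theory.
Import numFieldNormedType.Exports.

Local Open Scope classical_set_scope.
Local Open Scope ring_scope.
Local Open Scope complex_scope.

(* Up to an even permutation of its rows the matrix of the system is bordered
   diagonal, so its determinant is the product of the diagonal entries times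
   a 2 x 2 Schur complement; entries that vanish are handled by perturbing
   them with an indeterminate.
   For equal edges and an even potential, reflecting C and S about the
   midpoint and expanding the reflections in C, S gives C^2 - C' S = 1 and
   S (C - S') = 0.  With T the sum of the tau_j and U that of their inverses,
   the determinant becomes (prod tau) S^(2n-2) (T U - (2n)^2 S'^2) when
   S <> 0, and T U = 4 K^2 where K is the cosine sum.
   Uniqueness for the initial value problem with integrable potential is a
   Gronwall argument. *)

(** * The bordered determinant *)

(* The system of the problem has p i = tau_i S_i, g l = C_1 - tau_l C_l and
   e k = tau_k S_k'. *)
Definition bordered_mx (R : pzRingType) (N : nat) (p g e : nat -> R) (D : R) :
    'M[R]_N.+1 :=
  \matrix_(i, j)
    if i == 0%N :> nat then (if j == 0%N :> nat then 0 else 1)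
    else if i == N :> nat then (if j == 0%N :> nat then D else e j)
    else if j == 0%N :> nat then g i.+1
    else if j == 1%N :> nat then p 1%N
    else if j == i.+1 :> nat then - p i.+1
    else 0.

(** The value claimed in part (a), with [D] standing for the sum of the tau_k C_k'. It is free of
    division, so it makes sense over polynomials as well as over their fraction field. *)
Definition bordered_det (R : pzRingType) (N : nat) (p g e : nat -> R) (D : R) :
    R :=
  - D * (\sum_(1 <= l < N.+1) \prod_(1 <= i < N.+1 | i != l) p i)
  + \sum_(2 <= l < N.+1) g l *
      (\sum_(1 <= k < N.+1 | k != l)
         (\prod_(1 <= i < N.+1 | (i != l) && (i != k)) p i) * (e k - e l)).

Lemma det_mx2 (R : comPzRingType) (A : 'M[R]_2) :
  \det A = A 0 0 * A 1 1 - A 0 1 * A 1 0.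
Proof.
rewrite (expand_det_row _ 0) !big_ord_recl big_ord0 addr0 /cofactor.
rewrite !det_mx11 !mxE /= expr0 mul1r expr1 mulN1r mulrN.
by congr (_ * A _ _ - A _ _ * A _ _); apply/val_inj.
Qed.

(** Together with [bordered_mx_morph] this transports the determinant identity between a ring, its
    polynomials and their field of fractions. *)
Lemma bordered_det_morph (R S : pzRingType) (f : {rmorphism R -> S}) N p g e D :
  f (bordered_det N p g e D) =
  bordered_det N (f \o p) (f \o g) (f \o e) (f D).
Proof.
rewrite rmorphD rmorphM rmorphN !rmorph_sum; congr (_ * _ + _).
  by apply: eq_bigr => l _; rewrite rmorph_prod.
apply: eq_bigr => l _; rewrite rmorphM rmorph_sum; congr (_ * _).
by apply: eq_bigr => k _; rewrite rmorphM rmorphB rmorph_prod.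
Qed.

Lemma bordered_mx_morph (R S : pzRingType) (f : {rmorphism R -> S}) N p g e D :
  map_mx f (bordered_mx N p g e D) =
  bordered_mx N (f \o p) (f \o g) (f \o e) (f D).
Proof.
by apply/matrixP => i j; rewrite !mxE /=; repeat case: ifP => _;
  rewrite ?(rmorph0, rmorph1, rmorphN).
Qed.

(* Cycling the last row to the top turns the system into a block matrix whose
   lower right block is diagonal, and a Schur complement leaves a 2 x 2
   determinant. *)
Lemma det_bordered_mx_field (F : fieldType) N (p g e : nat -> F) (D : F) :
    (0 < N)%N -> (forall l, (1 <= l <= N)%N -> p l != 0) ->
  \det (bordered_mx N p g e D) =
    - (\prod_(1 <= i < N.+1) p i) *
      ((D + \sum_(2 <= l < N.+1) e l * (g l / p l)) * (\sum_(1 <= k < N.+1) (p k)^-1)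
       - (\sum_(1 <= k < N.+1) e k / p k) * (\sum_(2 <= l < N.+1) g l / p l)).
Proof.
case: N => // m _ p0.
pose M := bordered_mx m.+1 p g e D.
pose P : 'M[F]_(2 + m) := row_perm (lift_perm ord0 ord_max 1) M.
have detP : \det P = (-1) ^+ m.+1 * \det M.
  rewrite /P row_permE det_mulmx det_perm odd_lift_perm odd_perm1 addbF.
  by rewrite -[in RHS]signr_odd.
(* [W] holds the multiples of the diagonal columns to be added to the first two columns so as to
   clear the lower left block. *)
pose W : 'M[F]_(m, 2) := \matrix_(i, j)
  if j == 0 then g i.+2 / p i.+2 else p 1%N / p i.+2.
pose d : 'rV[F]_m := \row_i - p i.+2.
have P0 j : P 0 j = if j == 0%N :> nat then D else e j.
  by rewrite mxE lift_perm_id mxE /= eqxx.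
have PS (i : 'I_m.+1) j : P (lift ord0 i) j = M (lift ord_max i) j.
  by rewrite mxE lift_perm_lift perm1.
have P1 j : P 1 j = if j == 0%N :> nat then 0 else 1.
  have -> : 1 = lift ord0 ord0 :> 'I_(2 + m) by apply/val_inj.
  by rewrite PS mxE.
have P2 (i : 'I_m) j : P (rshift 2 i) j =
    if j == 0%N :> nat then g i.+2 else if j == 1%N :> nat then p 1%N
    else if j == i.+2 :> nat then - p i.+2 else 0.
  have -> : rshift 2 i = lift ord0 (lift ord0 i) by apply/val_inj.
  rewrite PS mxE /= /bump /= leqNgt !ltnS.
  rewrite ltn_ord /= add0n; have := ltn_ord i.
  by rewrite ltn_neqAle => /andP[/negPf im _]; rewrite eqSS im.
have dr : drsubmx P = diag_mx d.
  apply/matrixP => i j; rewrite [LHS]mxE [LHS]mxE P2 !mxE /= !eqSS.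
  by rewrite val_eqE eq_sym; case: eqP => [->|]; rewrite ?mulr1n.
have dl : dlsubmx P = - (diag_mx d *m W).
  apply/matrixP => i j; rewrite [LHS]mxE [LHS]mxE P2 !mxE (bigD1 i) //=.
  rewrite big1 ?addr0; last by move=> k ki; rewrite !mxE eq_sym (negPf ki) mul0r.
  rewrite !mxE eqxx mulr1n mulNr opprK.
  by case: j => -[|[|//]] /= jP; rewrite mulrC divfK // p0 //= ltnS ltn_ord.
(* The column operations are a multiplication by the unipotent matrix [T]; the result is block
   triangular, with the Schur complement in the upper left corner. *)
pose T : 'M[F]_(2 + m) := block_mx 1%:M 0 W 1%:M.
have PT : P *m T = block_mx (ulsubmx P + ursubmx P *m W) (ursubmx P) 0 (diag_mx d).
  rewrite -{1}[P]submxK mulmx_block dr dl !mulmx1 !mulmx0 !add0r addNr.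
  by congr block_mx.
have detT : \det T = 1 by rewrite /T det_lblock !det1 mulr1.
have /(congr1 determinant) := PT; rewrite det_mulmx detT mulr1 detP det_ublock.
move/(congr1 ( *%R ((-1) ^+ m.+1))).
rewrite mulrA -expr2 sqrr_sign mul1r => ->.
rewrite det_diag; under eq_bigr do rewrite mxE.
rewrite prodrN card_ord det_mx2.
have colS (f : nat -> F) : \sum_(k < m) f k.+2 = \sum_(2 <= l < m.+2) f l.
  by rewrite !big_add1 big_mkord.
have L0 iP : lshift m (@Ordinal 2 0 iP) = 0 :> 'I_(2 + m) by apply/val_inj.
have L1 iP : lshift m (@Ordinal 2 1 iP) = 1 :> 'I_(2 + m) by apply/val_inj.
have urW i j : (ursubmx P *m W) i j =
    \sum_(k < m) (if i == 0 then e k.+2 else 1) *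
      (if j == 0 then g k.+2 / p k.+2 else p 1%N / p k.+2).
  rewrite mxE; apply: eq_bigr => k _; rewrite [X in X * _]mxE [X in X * _]mxE.
  rewrite [W _ _]mxE; congr (_ * _); case: i => -[|[|//]] iP.
    by rewrite L0 P0.
  by rewrite L1 P1.
have ulP i j : (ulsubmx P) i j =
    if i == 0 then (if j == 0 then D else e 1%N) else (if j == 0 then 0 else 1).
  rewrite [LHS]mxE [LHS]mxE; case: i => -[|[|//]] iP.
    by rewrite L0 P0; case: j => -[|[|//]] jP.
  by rewrite L1 P1; case: j => -[|[|//]] jP.
have addE (A B : 'M[F]_2) i j : (A + B) i j = A i j + B i j by rewrite mxE.
rewrite !addE !ulP !urW /= add0r.
have colE f : \sum_(k < m) f k.+2 * (p 1%N / p k.+2) =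
    p 1%N * \sum_(2 <= l < m.+2) f l / p l.
  by rewrite mulr_sumr -colS; apply: eq_bigr => k _; rewrite mulrCA.
rewrite (colS (fun k => e k * (g k / p k))) (colE e) (colE (fun=> 1)).
under [X in _ - _ * X]eq_bigr do rewrite mul1r.
rewrite (colS (fun k => g k / p k)).
rewrite [\prod_(1 <= i < _) _]big_ltn // [\sum_(1 <= k < _) (p k)^-1]big_ltn //.
rewrite [\sum_(1 <= k < _) _]big_ltn //.
have -> : \prod_(i < m) p i.+2 = \prod_(2 <= l < m.+2) p l.
  by rewrite !big_add1 big_mkord.
have -> : \sum_(2 <= l < m.+2) 1 / p l = \sum_(2 <= l < m.+2) (p l)^-1.
  by apply: eq_bigr => l _; rewrite mul1r.
have p1 := p0 1%N isT.
(* The cycling of rows contributes (-1)^(m+1) and the diagonal entries - p i contribute (-1)^m, so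
   one minus sign is left. *)
rewrite exprS mulN1r.
move: (\prod_(2 <= _ < _) _) (\sum_(2 <= _ < _) _ * (_ / _)) => Q A.
move: (\sum_(2 <= _ < _) (_)^-1) (\sum_(2 <= _ < _) (e _ / _)) => B E.
move: (\sum_(2 <= _ < _) (_ / _)) => G.
by rewrite -signr_odd; case: (odd m); rewrite ?expr1 ?expr0; field.
Qed.

(** With Q the full product of the [p i], the products omitting one or two indices are Q / p l and Q
    / (p l p k). This turns the Schur complement formula into the division-free one. *)
Lemma det_bordered_mx_neq0 (F : fieldType) N (p g e : nat -> F) (D : F) :
    (0 < N)%N -> (forall l, (1 <= l <= N)%N -> p l != 0) ->
  \det (bordered_mx N p g e D) = bordered_det N p g e D.
Proof.
move=> N0 p0; rewrite det_bordered_mx_field //.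
set Q := \prod_(1 <= i < N.+1) p i.
have Q1 l : (1 <= l <= N)%N -> \prod_(1 <= i < N.+1 | i != l) p i = Q / p l.
  move=> lN; rewrite /Q [in RHS](bigD1_seq l) ?iota_uniq ?mem_index_iota ?ltnS //=.
  by rewrite mulrC mulKf ?p0.
have Q2 l k : (1 <= l <= N)%N -> (1 <= k <= N)%N -> k != l ->
    \prod_(1 <= i < N.+1 | (i != l) && (i != k)) p i = Q / p l / p k.
  move=> lN kN kl; rewrite -Q1 //; apply: (canRL (mulfK (p0 _ kN))).
  rewrite mulrC [in RHS](big_rem k) /= ?mem_index_iota ?ltnS // kl.
  congr (_ * _); rewrite rem_filter ?iota_uniq // big_filter_cond.
  by apply: eq_bigl => i; rewrite andbC.
have S1 : \sum_(1 <= l < N.+1) \prod_(1 <= i < N.+1 | i != l) p i =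
    Q * \sum_(1 <= k < N.+1) (p k)^-1.
  by rewrite mulr_sumr; apply: eq_big_nat => l /Q1.
have S2 l : (1 <= l <= N)%N ->
    \sum_(1 <= k < N.+1 | k != l)
      (\prod_(1 <= i < N.+1 | (i != l) && (i != k)) p i) * (e k - e l) =
    Q / p l * (\sum_(1 <= k < N.+1) e k / p k - e l * \sum_(1 <= k < N.+1) (p k)^-1).
  move=> lN; rewrite mulr_sumr -sumrB mulr_sumr.
  (* The index k = l is omitted on the left only; its term on the right contains e l - e l and
     vanishes. *)
  rewrite [RHS](bigD1_seq l) ?iota_uniq ?mem_index_iota ?ltnS //= subrr mulr0 add0r.
  rewrite big_nat_cond [RHS]big_nat_cond; apply: eq_bigr => k /andP[kN kl].
  by rewrite Q2 // -mulrBl mulrACA mulrAC -!mulrA.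
rewrite /bordered_det S1.
rewrite [X in _ = _ + X](eq_big_nat _ _ (F2 := fun l =>
  Q * (\sum_(1 <= k < N.+1) e k / p k) * (g l / p l) -
  Q * (\sum_(1 <= k < N.+1) (p k)^-1) * (e l * (g l / p l)))); last first.
  move=> l /andP[l2 lN]; rewrite S2 ?lN ?(ltnW l2) //.
  by move: (\sum_(1 <= k < _) _) (\sum_(1 <= k < _) _) => A B; ring.
rewrite sumrB -!mulr_sumr.
by ring.
Qed.

(** Each [p l] is replaced by the nonzero polynomial [p l] + X. The identity holds in the fraction
    field of the polynomials, hence among the polynomials by injectivity, and evaluation at 0 gives
    it for [p]. *)
Lemma det_bordered_mx (R : idomainType) N (p g e : nat -> R) (D : R) :
  (0 < N)%N -> \det (bordered_mx N p g e D) = bordered_det N p g e D.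
Proof.
move=> N0.
pose P l : {poly R} := (p l)%:P + 'X.
have PE l : (P l).[0] = p l by rewrite !hornerE.
have P0 l : P l != 0.
  by rewrite -size_poly_eq0 /P addrC size_XaddC.
have : \det (bordered_mx N P (polyC \o g) (polyC \o e) D%:P) =
    bordered_det N P (polyC \o g) (polyC \o e) D%:P.
  apply/eqP; rewrite -tofrac_eq; apply/eqP.
  rewrite -det_map_mx bordered_mx_morph bordered_det_morph.
  by apply: det_bordered_mx_neq0 => // l _; rewrite /= tofrac_eq0.
move/(congr1 (horner_eval 0)); rewrite -det_map_mx bordered_mx_morph.
rewrite bordered_det_morph.
have -> : horner_eval 0 \o P = p by apply/funext => l; rewrite /= /horner_eval PE.
have E h : horner_eval 0 \o (polyC \o h) = h.
  by apply/funext => l; rewrite /= /horner_eval hornerC.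
by rewrite !E /= /horner_eval !hornerC.
Qed.

(** * Absolutely continuous functions *)

(** The differential equation holds only almost everywhere, so second derivatives can be bounded
    only in this sense. *)
Lemma le_normr_Rintegral_ae d (T : measurableType d) (R : realType)
    (mu : {measure set T -> \bar R}) (D : set T) (g h : T -> R) : measurable D ->
    mu.-integrable D (EFin \o g) -> mu.-integrable D (EFin \o h) ->
    (forall x, D x -> 0 <= h x) ->
    {ae mu, forall x, D x -> `|g x| <= h x} ->
  `|Rintegral mu D g| <= Rintegral mu D h.
Proof.
move=> mD gi hi h0 gh; have := le_normr_Rintegral mD gi; move=> /le_trans; apply.
have ngi : mu.-integrable D (EFin \o (fun x => `|g x|)) by exact: integrable_norm.
rewrite /Rintegral fine_le //.
- exact: integrable_fin_num.
- exact: integrable_fin_num.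
apply: ae_ge0_le_integral => //.
- exact: measurable_int ngi.
- exact: measurable_int hi.
Qed.

(** Real counterpart of [ac_deriv], to which the complex notion reduces through real and imaginary
    parts in [ac_derivP]. *)
Definition ac_deriv_real (R : realType) (l : R) (f g : R -> R) : Prop :=
  (@lebesgue_measure R).-integrable `]0, l[ (EFin \o g) /\
  forall x, 0 <= x <= l -> f x = f 0 + Rintegral (@lebesgue_measure R) `]0, x[ g.

(** * Lebesgue measure under the reflection x -> l - x *)

Section Reflection.
Context {R : realType}.
Local Notation mu := (@lebesgue_measure R).
Implicit Types (l : R) (A D : set R).

(* lebesgue_measure lives on measurableTypeR R, which is convertible to R with
   its canonical measurable structure but does not unify with it. *)
Lemma measurable_reflect l :
  @measurable_fun _ _ (measurableTypeR R) (measurableTypeR R) setT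
    (fun x : R => l - x).
Proof.
have h : measurable_fun setT (fun x : R => l - x).
  by apply: measurable_realfun.measurable_funB.
exact: h.
Qed.

(** Lebesgue measure is determined by the half-open intervals, and the preimage of ]a, b] is [l - b,
    l - a[, of the same length. *)
Lemma lebesgue_measure_reflect l A : measurable A ->
  pushforward mu (fun x : R => l - x : measurableTypeR R) A = mu A.
Proof.
have mphi := @measurable_reflect l.
move=> mA; apply/esym/lebesgue_measure_unique => //= _ [[a b]] _ <-.
rewrite /pushforward.
have -> : (fun x : R => l - x) @^-1` `]a, b] = `[l - b, l - a[%classic.
  by apply/seteqP; split => x /=; rewrite !in_itv /= => /andP[? ?];
    apply/andP; split; lra.
rewrite !lebesgue_measure_itv /= !lte_fin ltrD2l ltrN2 -!EFinB.
by case: ifP => // _; congr EFin; ring.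
Qed.

Lemma integrable_reflect l (f : R -> \bar R) : mu.-integrable setT f ->
  mu.-integrable setT (fun x => f (l - x)).
Proof.
have mphi := @measurable_reflect l.
move=> intf; have /integrableP[mf fi] := intf; apply/integrableP; split.
  move=> _ Y mY; have := mf measurableT Y mY; rewrite !setTI => mfY.
  by have := mphi measurableT _ mfY; rewrite setTI.
have := @ge0_integral_pushforward _ _ _ _ _ _ mphi mu setT (abse \o f).
rewrite preimage_setT /= => <- //.
  by rewrite (eq_measure_integral mu) // => A mA _; exact: lebesgue_measure_reflect.
exact: measurable_int (integrable_abse intf).
Qed.

Lemma Rintegral_reflect l D (g : R -> R) : measurable D ->
    mu.-integrable setT (EFin \o g) ->
  Rintegral mu ((fun x => l - x) @^-1` D) (fun x => g (l - x)) = Rintegral mu D g.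
Proof.
have mphi := @measurable_reflect l.
move=> mD gi; rewrite /Rintegral; congr fine.
have := @integral_pushforward _ _ _ _ _ _ mphi mu D (EFin \o g).
move=> /= <- //; first last.
- apply: (@integrableS _ _ _ _ setT) => //.
    by rewrite -[X in measurable X]setTI; apply: mphi.
  exact: (integrable_reflect l gi).
- exact: measurable_int gi.
by apply: eq_measure_integral => A mA _; exact: lebesgue_measure_reflect.
Qed.

Lemma ae_reflect l (P : R -> Prop) :
  {ae mu, forall x, P x} -> {ae mu, forall x, P (l - x)}.
Proof.
have mphi := @measurable_reflect l.
move=> [N [mN N0 PN]]; exists ((fun x => l - x) @^-1` N); split.
- by rewrite -[X in measurable X]setTI; apply: mphi.
- by rewrite -N0 -(lebesgue_measure_reflect l mN).
- by move=> x /= nP; apply: PN.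
Qed.

End Reflection.

(** * Indefinite integrals: increments, linear combinations, reflection *)

Section AcDeriv.
Context {R : realType}.
Local Notation mu := (@lebesgue_measure R).
Local Notation acr := (@ac_deriv_real R).
Implicit Types (l : R) (f g h : R -> R).

(** Extension by zero gives one function integrable on the whole line, so that integrability on each
    subinterval follows by restriction. *)
Lemma integrable_patch l g : mu.-integrable `]0, l[ (EFin \o g) ->
  mu.-integrable setT (EFin \o (g \_ `]0, l[)).
Proof.
by move=> gi; rewrite -restrict_EFin; apply/integrable_restrict; rewrite ?setTI.
Qed.

Lemma Rintegral_patch l g x : mu.-integrable `]0, l[ (EFin \o g) -> 0 <= x <= l ->
  Rintegral mu `]0, x[ g = Rintegral mu `[0, x] (g \_ `]0, l[).
Proof.
move=> gi /andP[x0 xl]; have gi0 := integrable_patch gi.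
rewrite -Rintegral_itv_bndo_bndc; last exact: integrableS gi0.
rewrite -Rintegral_itv_obnd_cbnd; last exact: integrableS gi0.
apply: eq_Rintegral => t; rewrite inE /= in_itv /= => /andP[t0 tx].
by rewrite /patch mem_set //= in_itv /= t0 (lt_le_trans tx).
Qed.

Lemma ac_deriv_realB l f g z x : acr l f g -> 0 <= z -> z <= x -> x <= l ->
  f x - f z = Rintegral mu `]z, x] (g \_ `]0, l[).
Proof.
move=> [gi fE] z0 zx xl; have gi0 := integrable_patch gi.
rewrite fE ?xl ?(le_trans z0) // [f z]fE ?z0 ?(le_trans zx) //.
rewrite !(Rintegral_patch gi) ?xl ?z0 ?(le_trans z0 zx) ?(le_trans zx) //.
rewrite -(@Rintegral_itvB _ _ (BLeft 0)) ?bnd_simp //; first by ring.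
exact: integrableS gi0.
Qed.

Lemma ac_deriv_real_lin l a b f1 g1 f2 g2 : acr l f1 g1 -> acr l f2 g2 ->
  acr l (fun x => a * f1 x + b * f2 x) (fun x => a * g1 x + b * g2 x).
Proof.
move=> [i1 e1] [i2 e2].
have I (c : R) (k : R -> R) (D : set R) : measurable D ->
    mu.-integrable D (EFin \o k) -> mu.-integrable D (EFin \o (fun x => c * k x)).
  by move=> mD ki; apply: (integrableZl _ _ ki).
split=> [|x /andP[x0 xl]].
  by apply: (integrableD _ (I a g1 _ _ i1) (I b g2 _ _ i2)).
have j1 : mu.-integrable `]0, x[ (EFin \o g1).
  by apply: integrableS i1 => //; exact: subset_itvl.
have j2 : mu.-integrable `]0, x[ (EFin \o g2).
  by apply: integrableS i2 => //; exact: subset_itvl.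
rewrite RintegralD //; [|exact: I|exact: I].
by rewrite !RintegralZl // e1 ?x0 // e2 ?x0 //; ring.
Qed.

Lemma ac_deriv_real_reflect l f g : 0 <= l -> acr l f g ->
  acr l (fun x => f (l - x)) (fun x => - g (l - x)).
Proof.
move=> l0 fg; have [gi fE] := fg; have gi0 := integrable_patch gi.
(* Extension by zero commutes with the reflection because ]0, l[ is symmetric about l / 2. *)
have gE : (fun x => (g \_ `]0, l[) (l - x)) = (fun x => g (l - x)) \_ `]0, l[.
  apply/funext => x; rewrite /patch; congr (if _ then _ else _).
  by rewrite !mem_setE !in_itv /=; apply/idP/idP => /andP[? ?];
    apply/andP; split; lra.
have gi1 : mu.-integrable `]0, l[ (EFin \o (fun x => g (l - x))).
  have := integrable_reflect l gi0; rewrite /comp.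
  rewrite (_ : (fun x => _) = EFin \o (fun x => g (l - x)) \_ `]0, l[); last first.
    by rewrite -gE.
  by rewrite -restrict_EFin => /integrable_restrict; rewrite setTI; apply.
split=> [|x /andP[x0 xl]]; first exact: integrableN gi1.
have gix : mu.-integrable `]0, x[ (EFin \o (fun x => g (l - x))).
  by apply: integrableS gi1 => //; exact: subset_itvl.
rewrite subr0; under eq_Rintegral do rewrite -mulN1r.
rewrite RintegralZl // mulN1r.
rewrite (Rintegral_patch gi1) ?x0 // -gE.
have -> : `[0, x]%classic = (fun t => l - t) @^-1` `[l - x, l].
  by apply/seteqP; split => t /=; rewrite !in_itv /= => /andP[? ?];
    apply/andP; split; lra.
rewrite Rintegral_reflect // -Rintegral_itv_obnd_cbnd; last exact: integrableS gi0.
by rewrite -(ac_deriv_realB fg); [ring|lra..].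
Qed.

End AcDeriv.

(** * A Gronwall argument with an integrable coefficient *)

Section Gronwall.
Context {R : realType}.
Local Notation mu := (@lebesgue_measure R).
Local Notation acr := (@ac_deriv_real R).

Lemma le0_geometric (a B : R) : (forall k : nat, a <= B / 2 ^+ k) -> a <= 0.
Proof.
move=> aB; apply/ler_addgt0Pl => e e0; rewrite addr0.
have [k Bk] : exists k : nat, B / e <= k%:R.
  exists (Num.truncn `|B / e|).+1.
  by apply: le_trans (ler_norm _) (ltW (truncnS_gt _)).
apply: le_trans (aB k) _; rewrite ler_pdivrMr ?exprn_gt0 //.
rewrite ler_pdivrMr // in Bk; apply: le_trans Bk _.
rewrite mulrC ler_wpM2l ?(ltW e0) //.
by rewrite -natrX ler_nat; apply/ltnW/ltn_expl.
Qed.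

Context {I : Type} (l : R) (f g : I -> R -> R) (h : R -> R) (B : R).
Hypothesis fg : forall i, acr l (f i) (g i).
Hypothesis hi : mu.-integrable `]0, l[ (EFin \o h).
Hypothesis h0 : forall x : R, 0 <= h x.
(** Any common bound [M] of the components controls every derivative by [h x * M]. This expresses a
    linear first-order system without forming a maximum over [I], and the exceptional null set does
    not depend on [M]. *)
Hypothesis gh : {ae mu, forall x, x \in `]0, l[ -> forall M : R,
  (forall i, `|f i x| <= M) -> forall i, `|g i x| <= h x * M}.
Hypothesis fB : forall i (x : R), 0 <= x <= l -> `|f i x| <= B.

Let h_ := h \_ `]0, l[.
Let H x := Rintegral mu `[0, x] h_.
Let hi_ : mu.-integrable setT (EFin \o h_) := integrable_patch hi.
Let h0_ (x : R) : 0 <= h_ x.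
Proof. by rewrite /h_ /patch; case: ifP. Qed.

Let HB (z x : R) : 0 <= z -> z <= x -> H x - H z = Rintegral mu `]z, x] h_.
Proof.
move=> z0 zx; rewrite -(@Rintegral_itvB _ _ (BLeft 0)) ?bnd_simp //.
exact: integrableS hi_.
Qed.

Let H_le (z x : R) : 0 <= z -> z <= x -> H z <= H x.
Proof.
by move=> z0 zx; rewrite -subr_ge0 HB //; apply: Rintegral_ge0 => t _; exact: h0_.
Qed.

(* Over a subinterval carrying at most half a unit of [h], a bound on the
   functions propagates to half that bound. *)
Lemma gronwall_step z x : 0 <= z -> z <= x -> x <= l -> H x - H z <= 2^-1 ->
  (forall i, f i z = 0) -> forall t i, z <= t <= x -> f i t = 0.
Proof.
move=> z0 zx xl Hxz fz t i tzx.
apply/eqP; rewrite -normr_le0.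
apply: (@le0_geometric _ B) => k; elim: k t i tzx => [|k IH] t i /andP[zt tx].
  by rewrite expr0 divr1 fB // (le_trans z0) // (le_trans tx).
have B0 : 0 <= B / 2 ^+ k by apply: le_trans (IH t i _); rewrite ?normr_ge0 ?zt.
have tl := le_trans tx xl.
rewrite -[f i t]subr0 -{1}(fz i) (ac_deriv_realB (fg i)) //.
have [gi _] := fg i.
have ci c : mu.-integrable `]z, t] (EFin \o (fun s => c * h_ s)).
  have : mu.-integrable `]z, t] (EFin \o h_) by exact: integrableS hi_.
  by move=> hz; apply: (integrableZl _ _ hz).
apply: (@le_trans _ _ (Rintegral mu `]z, t] (fun s => B / 2 ^+ k * h_ s))).
  apply: le_normr_Rintegral_ae => //.
  - by apply: integrableS (integrable_patch gi).
  - by move=> s _; rewrite mulr_ge0.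
  case: gh => N [mN N0 sN]; exists N; split => // s /= ns; apply: sN => /= ghs.
  apply: ns; rewrite in_itv /= => /andP[zs st].
  rewrite /h_ /patch; case: ifPn => [|_]; last by rewrite normr0 mulr0.
  rewrite mem_setE => sl; rewrite mulrC; apply: (ghs sl) => j.
  by apply: IH; rewrite ltW //= (le_trans st).
rewrite RintegralZl //; last by exact: integrableS hi_.
rewrite -HB // exprSr invfM mulrA ler_wpM2l //.
by apply: le_trans Hxz; rewrite lerD2r H_le // (le_trans z0).
Qed.

(* Induction on k over the level sets H <= k / 2. *)
Lemma ac_gronwall : (forall i, f i 0 = 0) ->
  forall i x, 0 <= x <= l -> f i x = 0.
Proof.
move=> f0; suff lev (k : nat) i x : 0 <= x <= l -> H x <= k%:R / 2 -> f i x = 0.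
  move=> i x xl; apply: (lev (Num.truncn `|H x * 2|).+1) => //.
  by rewrite ler_pdivlMr //; apply: le_trans (ler_norm _) (ltW (truncnS_gt _)).
have H0 : H 0 = 0 by rewrite /H set_itv1 Rintegral_set1.
elim: k i x => [|k IH] i x /andP[x0 xl] Hx.
  apply: (@gronwall_step 0 x) => //; rewrite ?x0 ?lexx //.
  by rewrite H0 subr0 (le_trans Hx) // mul0r invr_ge0.
have [Hk|kH] := leP (H x) (k%:R / 2); first by apply: IH => //; rewrite x0.
have cH : {within `[0, x], continuous H}.
  by apply: parameterized_integral_continuous => //; exact: integrableS hi_.
(* At [z] the integral [H] equals k / 2, so the functions vanish there by induction; from [z] to [x]
   it grows by at most 1 / 2, and [gronwall_step] applies. *)
have [|z] := @IVT R H 0 x (k%:R / 2) x0 cH.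
  have Hx0 : 0 <= H x by rewrite -H0 H_le.
  by rewrite H0 (min_idPl Hx0) (max_idPr Hx0) divr_ge0 //= ltW.
rewrite in_itv /= => /andP[z0 zx] Hz.
apply: (@gronwall_step z x) => //; rewrite ?zx ?lexx //.
  by move: Hx; rewrite Hz -natr1 mulrDl; lra.
by move=> j; apply: IH; rewrite ?z0 ?(le_trans zx) // Hz.
Qed.

End Gronwall.

(** * Sturm-Liouville equations *)

(** This lets the [filterS] lemmas combine several almost everywhere statements pointwise. *)
#[local] Instance lebesgue_ae_filter (R : realType) :
  Filter (nbhs (almost_everywhere (@lebesgue_measure R))).
Proof. exact: (@ae_filter_ringOfSetsType _ (measurableTypeR R)). Qed.

Section SturmLiouville.
Context {R : realType}.
Local Notation mu := (@lebesgue_measure R).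
Local Notation Re := (@complex.Re R).
Local Notation Im := (@complex.Im R).
Implicit Types (l : R) (q : R -> R) (lambda : R[i]).

Lemma complex_ext (z w : R[i]) : Re z = Re w -> Im z = Im w -> z = w.
Proof. by case: z w => [a b] [c d] /= -> ->. Qed.

Lemma ReM (z w : R[i]) : Re (z * w) = Re z * Re w - Im z * Im w.
Proof. by case: z w => [a b] [c d]. Qed.

Lemma ImM (z w : R[i]) : Im (z * w) = Re z * Im w + Im z * Re w.
Proof. by case: z w => [a b] [c d]. Qed.

Lemma ReD (z w : R[i]) : Re (z + w) = Re z + Re w.
Proof. by case: z w => [a b] [c d]. Qed.

Lemma ImD (z w : R[i]) : Im (z + w) = Im z + Im w.
Proof. by case: z w => [a b] [c d]. Qed.

Lemma ReN (z : R[i]) : Re (- z) = - Re z.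
Proof. by case: z. Qed.

Lemma ImN (z : R[i]) : Im (- z) = - Im z.
Proof. by case: z. Qed.

Lemma ac_derivP l (f g : R -> R[i]) : ac_deriv l f g <->
  ac_deriv_real l (Re \o f) (Re \o g) /\ ac_deriv_real l (Im \o f) (Im \o g).
Proof.
split=> [[[gr gi] fE]|[[gr fr] [gi fi]]].
  by split; split=> // x xl; rewrite /= fE //; case: (f 0).
split=> // x xl; apply: complex_ext.
  by move: (fr x xl) => /= ->; case: (f 0).
by move: (fi x xl) => /= ->; case: (f 0).
Qed.

Lemma ac_deriv_lin l (A B : R[i]) f1 g1 f2 g2 :
  ac_deriv l f1 g1 -> ac_deriv l f2 g2 ->
  ac_deriv l (fun x => A * f1 x + B * f2 x) (fun x => A * g1 x + B * g2 x).
Proof.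
move=> /ac_derivP[r1 i1] /ac_derivP[r2 i2]; apply/ac_derivP; split.
  (* The real part of A f1 + B f2 is a real combination of four functions, obtained by nesting
     combinations of two. *)
  have := ac_deriv_real_lin 1 1 (ac_deriv_real_lin (Re A) (- Im A) r1 i1)
    (ac_deriv_real_lin (Re B) (- Im B) r2 i2).
  congr (ac_deriv_real l _ _); apply/funext => x /=;
    by rewrite ReD !ReM !mul1r !mulNr.
have := ac_deriv_real_lin 1 1 (ac_deriv_real_lin (Re A) (Im A) i1 r1)
  (ac_deriv_real_lin (Re B) (Im B) i2 r2).
by congr (ac_deriv_real l _ _); apply/funext => x /=;
  rewrite ImD !ImM !mul1r.
Qed.

Lemma ac_deriv_reflect l f g : 0 <= l -> ac_deriv l f g ->
  ac_deriv l (fun x => f (l - x)) (fun x => - g (l - x)).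
Proof.
move=> l0 /ac_derivP[fr fi]; apply/ac_derivP; split.
  have := ac_deriv_real_reflect l0 fr.
  by congr (ac_deriv_real l _ _); apply/funext => x /=; rewrite ReN.
have := ac_deriv_real_reflect l0 fi.
by congr (ac_deriv_real l _ _); apply/funext => x /=; rewrite ImN.
Qed.

Lemma ac_deriv_real_bounded l (f g : R -> R) : ac_deriv_real l f g ->
  exists B : R, forall x, 0 <= x <= l -> `|f x| <= B.
Proof.
move=> fg; have [gi _] := fg; set g_ := g \_ `]0, l[.
have ngi : mu.-integrable setT (EFin \o (fun x => `|g_ x|)).
  exact: (integrable_norm (integrable_patch gi)).
exists (`|f 0| + Rintegral mu `]0, l] (fun x => `|g_ x|)) => x /andP[x0 xl].
rewrite -[f x](subrK (f 0)) addrC (le_trans (ler_normD _ _)) // lerD2l.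
rewrite (ac_deriv_realB fg) //.
apply: (@le_trans _ _ (Rintegral mu `]0, x] (fun x => `|g_ x|))).
  apply: le_normr_Rintegral => //.
  by apply: integrableS (integrable_patch gi).
rewrite -subr_ge0 (@Rintegral_itvB _ _ (BRight 0)) ?bnd_simp //.
  by apply: Rintegral_ge0.
exact: integrableS ngi.
Qed.

Lemma integrable_cst_itv l (c : R) :
  mu.-integrable `]0, l[ (EFin \o (fun=> c)).
Proof.
apply/integrableP; split; first exact: measurable_cst.
rewrite integral_cst //= lebesgue_measure_itv /=.
by case: ifP => _; rewrite ?mule0 // -?EFinB -?EFinM ltry.
Qed.

(** On a bounded interval 1 + q^2 is integrable, and it dominates |q|. *)
Lemma potential_integrable l q : potential l q -> mu.-integrable `]0, l[ (EFin \o q).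
Proof.
move=> pq; have q2 := Lfun2_integrable_sqr pq.
have mq : measurable_fun setT (q \_ `]0, l[).
  by move: pq; rewrite /potential inE => /andP[]; rewrite inE.
have i1 : mu.-integrable `]0, l[ (EFin \o (fun x => 1 + (q \_ `]0, l[) x ^+ 2)).
  have q2' : mu.-integrable `]0, l[ (EFin \o (fun x => (q \_ `]0, l[) x ^+ 2)).
    exact: integrableS q2.
  by apply: (integrableD _ (integrable_cst_itv l 1) q2').
suff : mu.-integrable `]0, l[ (EFin \o (q \_ `]0, l[)).
  apply: eq_integrable => // x xl.
  by rewrite /= /patch xl.
apply: le_integrable i1 => //.
  by apply/measurable_realfun.measurable_EFinP; apply: measurable_funTS.
move=> x _; rewrite /= lee_fin; move: (patch _ _ _ _) => t.
rewrite [leRHS]ger0_norm ?addr_ge0 ?sqr_ge0 //.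
rewrite -(real_normK (num_real t)).
(* Expanding this square gives |t| <= t^2 + 1/4. *)
have := sqr_ge0 (`|t| - 2^-1); lra.
Qed.

Lemma sl_solution_lin q l lambda (A B : R[i]) y dy z dz :
  sl_solution q l lambda y dy -> sl_solution q l lambda z dz ->
  sl_solution q l lambda (fun x => A * y x + B * z x)
    (fun x => A * dy x + B * dz x).
Proof.
move=> [y1 [d2y [y2 yE]]] [z1 [d2z [z2 zE]]]; split; first exact: ac_deriv_lin.
exists (fun x => A * d2y x + B * d2z x); split; first exact: ac_deriv_lin.
apply: filterS2 yE zE => x yE zE xl.
have -> : - (A * d2y x + B * d2z x) + (q x)%:C * (A * y x + B * z x) =
  A * (- d2y x + (q x)%:C * y x) + B * (- d2z x + (q x)%:C * z x) by ring.
by rewrite yE // zE //; ring.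
Qed.

Lemma sl_solution_ae_eq q q' l lambda y dy :
  {ae mu, forall x, x \in `]0, l[ -> q x = q' x} ->
  sl_solution q l lambda y dy -> sl_solution q' l lambda y dy.
Proof.
move=> qq [y1 [d2y [y2 yE]]]; split => //; exists d2y; split => //.
by apply: filterS2 qq yE => x qq yE xl; rewrite -qq // yE.
Qed.

Lemma sl_solution_reflect q l lambda y dy : 0 <= l ->
  {ae mu, forall x, x \in `]0, l[ -> q (l - x) = q x} ->
  sl_solution q l lambda y dy ->
  sl_solution q l lambda (fun x => y (l - x)) (fun x => - dy (l - x)).
Proof.
move=> l0 qq [y1 [d2y [y2 yE]]]; split; first exact: ac_deriv_reflect.
exists (fun x => d2y (l - x)); split.
  (* Reflecting [dy] yields the derivative - d2y (l - x); the coefficients -1 and 0 merely change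
     its sign. *)
  have := ac_deriv_lin (-1) 0 (ac_deriv_reflect l0 y2) (ac_deriv_reflect l0 y2).
  by congr (ac_deriv l _ _); apply/funext => x; ring.
apply: filterS2 qq (ae_reflect l yE) => x qq yE' xl.
rewrite -yE' ?qq //.
by move: xl; rewrite !in_itv /= => /andP[? ?]; apply/andP; split; lra.
Qed.

(** The real and imaginary parts of y and y' satisfy a real first-order system of four equations
    whose coefficients are bounded by an integrable function, and [ac_gronwall] applies. *)
Lemma sl_solution_unique q l lambda y dy : potential l q ->
    sl_solution q l lambda y dy -> y 0 = 0 -> dy 0 = 0 ->
  forall x, 0 <= x <= l -> y x = 0 /\ dy x = 0.
Proof.
move=> /potential_integrable qi [y1 [d2y [y2 yE]]] y0 dy0.
pose part (b : bool) := if b then Im else Re.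
(* The first boolean chooses between y and y', the second between real and imaginary part. *)
pose f (i : bool * bool) := part i.2 \o (if i.1 then dy else y).
pose g (i : bool * bool) := part i.2 \o (if i.1 then d2y else dy).
pose L := `|Re lambda| + `|Im lambda|.
(* The summand 1 serves the equations for the derivative of y, the others serve y'' = (q - lambda)
   y. *)
pose h x := 1 + L + `|q x|.
have L0 : 0 <= L by rewrite addr_ge0.
have fg i : ac_deriv_real l (f i) (g i).
  by move: i => [[] []]; case/ac_derivP: y1; case/ac_derivP: y2.
have [b bP] := choice (fun i => ac_deriv_real_bounded (fg i)).
suff f0 : forall i x, 0 <= x <= l -> f i x = 0.
  move=> x xl; split; apply: complex_ext.
  - exact: (f0 (false, false)).
  - exact: (f0 (false, true)).
  - exact: (f0 (true, false)).
  - exact: (f0 (true, true)).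
apply: (ac_gronwall (g := g) (h := h) (B := \sum_i `|b i|)) => //.
- by apply: (integrableD _ (integrable_cst_itv l (1 + L)) (integrable_norm qi)).
- by move=> t; rewrite /h !addr_ge0.
- apply: filterS yE => t yE tl M fM j.
  have M0 : 0 <= M by apply: le_trans (fM (false, false)).
  have fr : `|Re (y t)| <= M := fM (false, false).
  have fi : `|Im (y t)| <= M := fM (false, true).
  have d2E : d2y t = (q t)%:C * y t - lambda * y t.
    by rewrite -yE //; ring.
  have bound u v : `|u| <= M -> `|v| <= M ->
      `|q t * u - (Re lambda * u + Im lambda * v)| <= h t * M.
    move=> uM vM; apply: le_trans (ler_normB _ _) _.
    rewrite normrM; apply: le_trans (lerD (lexx _) (ler_normD _ _)) _.
    rewrite !normrM /h /L !mulrDl mul1r.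
    have := ler_wpM2l (normr_ge0 (q t)) uM.
    have := ler_wpM2l (normr_ge0 (Re lambda)) uM.
    have := ler_wpM2l (normr_ge0 (Im lambda)) vM.
    lra.
  have Mh : M <= h t * M.
    by rewrite /h -[leLHS]mul1r -addrA ler_wpM2r // lerDl addr_ge0.
  case: j => [[] []]; rewrite /g /= ?d2E.
  + rewrite ImD ImN !ImM /= mul0r addr0.
    by have := bound (Im (y t)) (Re (y t)) fi fr; congr (`|_| <= _); ring.
  + rewrite ReD ReN !ReM /= mul0r subr0.
    have := bound (Re (y t)) (- Im (y t)) fr; rewrite normrN => /(_ fi).
    by congr (`|_| <= _); ring.
  + exact: le_trans (fM (true, true)) Mh.
  + exact: le_trans (fM (true, false)) Mh.
- move=> i x xl; apply: le_trans (bP i x xl) _.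
  rewrite (bigD1 i) //=; apply: le_trans (ler_norm _) _.
  by rewrite lerDl sumr_ge0.
- by case=> [[] []]; rewrite /f /= ?y0 ?dy0.
Qed.

(** The difference of the two sides solves the equation with zero initial data. *)
Lemma sl_solution_expand q l (C dC S dS : R -> R[i] -> R[i]) rho y dy :
    potential l q -> fundamental_solutions q l C dC S dS ->
    sl_solution q l (rho ^+ 2) y dy ->
  forall x, 0 <= x <= l ->
    y x = y 0 * C x rho + dy 0 * S x rho /\
    dy x = y 0 * dC x rho + dy 0 * dS x rho.
Proof.
move=> pq fCS ysol x xl; have [sC sS [C0 dC0] [S0 dS0]] := fCS rho.
have sCS := sl_solution_lin (y 0) (dy 0) sC sS.
have := sl_solution_unique pq (sl_solution_lin 1 (-1) ysol sCS).
rewrite C0 S0 dC0 dS0 => /(_ _ _ x xl) [||y0 dy0]; [by ring|by ring|].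
by split; apply/subr0_eq; [rewrite -[RHS]y0|rewrite -[RHS]dy0]; ring.
Qed.

End SturmLiouville.

(** * Values of C and S: even potentials and nontriviality *)

Section Boundary.
Context {R : realType}.
Local Notation mu := (@lebesgue_measure R).

(** The reflection of C solves the same equation with initial data C(l), - C'(l), and that of S with
    initial data S(l), - S'(l). Expanded in C and S and evaluated at l, where they equal C(0) = 1
    and S(0) = 0, they give the two identities. *)
Lemma even_boundary_values (q : R -> R) (l : R) (C dC S dS : R -> R[i] -> R[i]) rho :
    0 <= l -> potential l q ->
    {ae mu, forall x, x \in `]0, l[ -> q (l - x) = q x} ->
    fundamental_solutions q l C dC S dS ->
  C l rho ^+ 2 - dC l rho * S l rho = 1 /\ S l rho * (C l rho - dS l rho) = 0.
Proof.
move=> l0 pq qe fCS; have [sC sS [C0 dC0] [S0 dS0]] := fCS rho.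
have ll : 0 <= l <= l by rewrite l0 lexx.
have [] := sl_solution_expand pq fCS (sl_solution_reflect l0 qe sC) ll.
have [] := sl_solution_expand pq fCS (sl_solution_reflect l0 qe sS) ll.
rewrite /= !subrr !subr0 C0 S0 => sE _ cE _; split.
  by rewrite [RHS]cE; ring.
by rewrite [RHS]sE; ring.
Qed.

(** If S vanished on [0, l], then S'' = 0 almost everywhere, so Re S' would be constantly 1 and Re
    S(l) would equal l > 0. The lemma makes a null vector with vanishing first entry yield a nonzero
    solution. *)
Lemma sine_neq0 (q : R -> R) (l : R) (C dC S dS : R -> R[i] -> R[i]) rho :
    0 < l -> fundamental_solutions q l C dC S dS ->
  exists2 x, 0 <= x <= l & S x rho != 0.
Proof.
move=> l0 fCS; apply: contrapT => nS.
have S0 x : 0 <= x <= l -> S x rho = 0.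
  by move=> xl; apply/eqP; apply: contrapT => /negP Sx; apply: nS; exists x.
have [_ [S1 [d2S [S2 SE]]] _ [_ dS0]] := fCS rho.
have /ac_derivP[[_ fS] _] := S1; have /ac_derivP[[gi fdS] _] := S2.
have dS1 x : 0 <= x <= l -> complex.Re (dS x rho) = 1.
  move=> xl; have /= -> := fdS x xl; rewrite dS0 /= -[RHS]addr0; congr (_ + _).
  apply/eqP; rewrite -normr_le0.
  apply: (@le_trans _ _ (Rintegral mu `]0, x[ (fun=> 0))); last first.
    by rewrite Rintegral_cst // mul0r.
  case/andP: xl => x0 xl.
  apply: le_normr_Rintegral_ae => //.
  - by apply: integrableS gi => //; exact: subset_itvl.
  - by apply: integrableS (integrable_cst_itv l 0) => //; exact: subset_itvl.
  apply: filterS SE => t tE /=; rewrite in_itv /= => /andP[t0 tx].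
  have tl : t < l := lt_le_trans tx xl.
  have := tE; rewrite in_itv /= t0 tl => /(_ isT).
  rewrite S0 ?(ltW t0) ?(ltW tl) // !mulr0 addr0 => /eqP.
  by rewrite oppr_eq0 => /eqP ->; rewrite normr0.
have := fS l; rewrite /= !S0 ?lexx ?(ltW l0) // => /(_ isT) /eqP.
rewrite /= add0r (@eq_Rintegral _ _ _ mu `]0, l[ (fun=> 1)); last first.
  by move=> x; rewrite inE /= in_itv /= => /andP[x0 xl] /=; rewrite dS1 // !ltW.
rewrite Rintegral_cst //= mul1r lebesgue_measure_itv /= lte_fin l0 /= subr0.
by rewrite eq_sym (gt_eqF l0).
Qed.

End Boundary.

(** * Sums and products of the tau_j *)

Section Phases.
Context {R : realType}.
Implicit Types (n : nat) (theta : nat -> R) (x y : R).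

Lemma expiD x y : expi (x + y) = expi x * expi y.
Proof.
by apply: complex_ext; rewrite ?ReM ?ImM /= ?cosD ?sinD; ring.
Qed.

Lemma expi0 : expi (0 : R) = 1.
Proof. by rewrite /expi cos0 sin0. Qed.

Lemma expi_neq0 x : expi x != 0.
Proof.
apply/eqP => x0; have := expiD x (- x).
by rewrite subrr expi0 x0 mul0r => /eqP; rewrite oner_eq0.
Qed.

Lemma expiV x : (expi x)^-1 = expi (- x).
Proof.
by apply: (mulfI (expi_neq0 x)); rewrite mulfV ?expi_neq0 // -expiD subrr expi0.
Qed.

Lemma expiX x k : expi x ^+ k = expi (k%:R * x).
Proof.
elim: k => [|k IH]; first by rewrite mul0r expi0.
by rewrite exprS IH -expiD -natr1 mulrDl mul1r addrC.
Qed.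

(** The exponents lie symmetrically about y / 2, at distance v = (y - 2 x) / 2, and e^(iv) + e^(-iv)
    = 2 cos v. *)
Lemma expi_pair x y :
  expi x + expi (y - x) = 2 * expi (y / 2) * (cos ((y - 2 * x) / 2))%:C.
Proof.
set u := y / 2; set v := (y - _) / 2.
have -> : y - x = u + v by rewrite /u /v; field.
have -> : x = u - v by rewrite /u /v; field.
rewrite !expiD (_ : 2 = (2 : R)%:C); last by rewrite rmorph_nat.
by apply: complex_ext; rewrite ?(ReM, ImM, ReD, ImD) /= cosN sinN; ring.
Qed.

(** Since tau_1 = 1, the first exponent is 0; theta_1 enters the tau_j only through Theta. *)
Definition phase theta j : R := if j == 1%N then 0 else theta j.

Lemma tau_phase n theta j : (1 <= j <= n)%N -> tau n theta j = expi (phase theta j).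
Proof.
by move=> /andP[j1 jn]; rewrite /tau /phase jn; case: eqP => // _; rewrite expi0.
Qed.

Lemma tau_phase_rev n theta j : (1 <= j <= n)%N ->
  tau n theta ((2 * n).+1 - j) = expi (theta_sum n theta - phase theta j).
Proof.
move=> /andP[j1 jn]; rewrite /tau /phase.
have -> : ((2 * n).+1 - j == 1)%N = false by lia.
have -> : ((2 * n).+1 - j <= n)%N = false by lia.
have -> : ((2 * n).+1 - j <= (2 * n).-1)%N = (j != 1%N) by lia.
case: eqP => [_|_] /=; first by rewrite subr0.
by congr (expi (_ - theta _)); lia.
Qed.

(** Pairing j with 2n + 1 - j suits the tau_j, since the product of each such pair is e^(i
    Theta). *)
Lemma big_fold_nat (T : Type) (idx : T) (op : Monoid.com_law idx) n (F : nat -> T) :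
  \big[op/idx]_(1 <= j < (2 * n).+1) F j =
  \big[op/idx]_(1 <= j < n.+1) op (F j) (F ((2 * n).+1 - j)%N).
Proof.
rewrite big_split (big_cat_nat _ (n := n.+1)) //=; last by lia.
congr (op _ _); rewrite big_nat_rev /=.
have -> : \big[op/idx]_(n.+1 <= i < (2 * n).+1) F (n.+1 + (2 * n).+1 - i.+1)%N =
    \big[op/idx]_(1 + n <= i < n.+1 + n) F (n.+1 + (2 * n).+1 - i.+1)%N.
  by congr (\big[op/idx]_(_ <= i < _) _); lia.
rewrite big_addn addnK; apply: eq_big_nat => i /andP[i1 iN].
by congr F; lia.
Qed.

Lemma cos_sum_phase n theta : (0 < n)%N -> cos_sum n theta =
  \sum_(1 <= j < n.+1) cos ((theta_sum n theta - 2 * phase theta j) / 2).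
Proof.
move=> n0; rewrite /cos_sum [RHS]big_ltn //= /phase /= mulr0 subr0; congr (_ + _).
by apply: eq_big_nat => -[|[|j]].
Qed.

Lemma sum_tau n theta : (0 < n)%N ->
  \sum_(1 <= j < (2 * n).+1) tau n theta j =
  2 * expi (theta_sum n theta / 2) * (cos_sum n theta)%:C.
Proof.
move=> n0; rewrite big_fold_nat cos_sum_phase // rmorph_sum mulr_sumr.
by apply: eq_big_nat => j jn; rewrite tau_phase // tau_phase_rev // -expi_pair.
Qed.

(** The inverses have opposite exponents, and the cosine is even: the same cosine sum appears with
    the conjugate phase, which cancels that of [sum_tau] in a product. *)
Lemma sum_tauV n theta : (0 < n)%N ->
  \sum_(1 <= j < (2 * n).+1) (tau n theta j)^-1 =
  2 * expi (- (theta_sum n theta / 2)) * (cos_sum n theta)%:C.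
Proof.
move=> n0; rewrite big_fold_nat cos_sum_phase // rmorph_sum mulr_sumr.
apply: eq_big_nat => j jn; rewrite tau_phase // tau_phase_rev // !expiV.
rewrite opprD /= expi_pair mulNr; congr (_ * (_)%:C).
by rewrite -cosN; congr cos; field.
Qed.

Lemma prod_tau n theta :
  \prod_(1 <= j < (2 * n).+1) tau n theta j = expi (n%:R * theta_sum n theta).
Proof.
rewrite big_fold_nat -expiX.
rewrite (eq_big_nat _ _ (F2 := fun=> expi (theta_sum n theta))).
  by rewrite prodr_const_nat subn1.
by move=> j jn; rewrite tau_phase // tau_phase_rev //= -expiD addrC subrK.
Qed.

Lemma tau_neq0 n theta j : tau n theta j != 0.
Proof.
by rewrite /tau; repeat case: ifP => _; rewrite ?oner_neq0 ?expi_neq0.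
Qed.

End Phases.

(** * The characteristic function *)

Section System.
Context {R : realType}.
Implicit Types (n : nat) (theta a : nat -> R).

Lemma system_matrixE n (t c s dc ds : nat -> R[i]) : t 1%N = 1 ->
  system_matrix n t c s dc ds =
  bordered_mx (2 * n) (fun i => t i * s i) (fun l => c 1%N - t l * c l)
    (fun k => t k * ds k) (\sum_(1 <= m < (2 * n).+1) t m * dc m).
Proof.
move=> t1; apply/matrixP => i j; rewrite !mxE /=.
do 3 (case: ifP => // _); first by case: eqP => // ->; rewrite t1 mul1r.
by rewrite t1 mul1r.
Qed.

(** The rows applied to a vector of coefficients are the vertex conditions, which links the null
    space of the matrix to the boundary value problem. *)
Lemma bordered_mx_mul (K : comPzRingType) N (p g e w : nat -> K) (D : K)
    (i : 'I_N.+1) :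
    (0 < N)%N ->
  \sum_j bordered_mx N p g e D i j * w j =
    if i == 0%N :> nat then \sum_(1 <= k < N.+1) w k
    else if i == N :> nat then D * w 0%N + \sum_(1 <= k < N.+1) e k * w k
    else g i.+1 * w 0%N + p 1%N * w 1%N - p i.+1 * w i.+1.
Proof.
move=> N0; rewrite big_ord_recl !mxE /=.
have recl (F : nat -> K) : \sum_(1 <= k < N.+1) F k = \sum_(k < N) F (bump 0 k).
  by rewrite big_add1 big_mkord.
rewrite !recl; case: (eqVneq (i : nat) 0%N) => i0.
  by rewrite mul0r add0r; apply: eq_bigr => k _; rewrite mxE /= i0 mul1r.
case: (eqVneq (i : nat) N) => iN.
  by congr (_ + _); apply: eq_bigr => k _; rewrite mxE /= (negPf i0) iN eqxx.
rewrite -addrA; congr (_ + _).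
have iN' : (i < N)%N by rewrite ltn_neqAle iN -ltnS ltn_ord.
(* The index k stands for column k + 1, so these two are the columns 1 and i + 1, the only ones
   beyond column 0 where a middle row can be nonzero. *)
rewrite (bigD1 (Ordinal N0)) //= (bigD1 (Ordinal iN')) /=; last first.
  by rewrite -val_eqE.
rewrite big1 => [|k /andP[]]; rewrite -?val_eqE /=.
  by rewrite !mxE /= /bump /= !add1n !(negPf i0, negPf iN) !eqSS (negPf i0) eqxx
    addr0 mulNr.
move=> k0 ki; rewrite mxE /= /bump /= !add1n (negPf i0) (negPf iN) !eqSS.
by rewrite (negPf k0) (negPf ki) mul0r.
Qed.

Lemma edge_length_gt0 n a j : (forall j, (1 <= j <= n)%N -> 0 < a j) ->
  (1 <= j <= 2 * n)%N -> 0 < edge_length n a j.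
Proof. by move=> a0 jn; rewrite /edge_length; case: ifP => jn'; apply: a0; lia. Qed.

Lemma has_nontrivial_solutionP n theta a (q : nat -> R -> R)
    (Cj dCj Sj dSj : nat -> R -> R[i] -> R[i]) rho :
    (0 < n)%N -> (forall j, (1 <= j <= n)%N -> 0 < a j) ->
    (forall j, (1 <= j <= 2 * n)%N -> potential (edge_length n a j) (q j)) ->
    (forall j, (1 <= j <= 2 * n)%N ->
       fundamental_solutions (q j) (edge_length n a j)
         (Cj j) (dCj j) (Sj j) (dSj j)) ->
  has_nontrivial_solution n theta a q rho <-> Phi n theta a Cj dCj Sj dSj rho = 0.
Proof.
move=> n0 a0 hq hCS; rewrite /Phi /has_nontrivial_solution /=.
set l := edge_length n a; set t := tau n theta.
have t1 : t 1%N = 1 by [].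
have N0 : (0 < 2 * n)%N by rewrite muln_gt0.
have l0 j : (1 <= j <= 2 * n)%N -> 0 < l j by apply: edge_length_gt0.
have ll j : (1 <= j <= 2 * n)%N -> 0 <= l j <= l j.
  by move=> /l0 /ltW ->; rewrite lexx.
have one : (1 <= 1 <= 2 * n)%N by [].
rewrite system_matrixE //; set M := bordered_mx _ _ _ _ _.
split=> [[y [dy [sol [j0 [x0 [j0n x0l yx0]]] [y0E dy0] [ylE dyl]]]]|].
  (* By the expansion in C_k and S_k, the null vector consists of the common value A = y_1(0) and
     the slopes B_k = y_k'(0). *)
  pose w k := if k == 0%N then y 1%N 0 else dy k 0.
  have y0 j : (1 <= j <= 2 * n)%N -> y j 0 = y 1%N 0.
    by move=> jn; case: (eqVneq j 1%N) => [->//|j1]; rewrite (y0E j) //; lia.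
  have yx j x : (1 <= j <= 2 * n)%N -> 0 <= x <= l j ->
      y j x = w 0%N * Cj j x rho + w j * Sj j x rho /\
      dy j x = w 0%N * dCj j x rho + w j * dSj j x rho.
    move=> jn xl; have := sl_solution_expand (hq j jn) (hCS j jn) (sol j jn) xl.
    by rewrite y0 // /w /=; case: j jn {xl} => [|j].
  pose v := \row_(k < (2 * n).+1) w k.
  have Mv i : \sum_j M i j * w j = 0.
    rewrite bordered_mx_mul //; case: eqP => i0.
      rewrite -[RHS]dy0; apply: eq_big_nat => k /andP[k1 _].
      by rewrite /w gtn_eqF.
    case: eqP => iN.
      rewrite mulr_suml -big_split -[RHS]dyl /=; apply: eq_big_nat => k kn.
      by have [_ ->] := yx k (l k) kn (ll k kn); ring.
    have iN' : (1 <= i.+1 <= 2 * n)%N by move: (ltn_ord i); lia.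
    have := ylE i.+1; rewrite (yx _ _ one (ll _ one)).1 (yx _ _ iN' (ll _ iN')).1.
    move=> /(_ _)/eqP; rewrite -subr_eq0 => yl.
    have -> : 0 = w 0%N * Cj 1%N (l 1%N) rho + w 1%N * Sj 1%N (l 1%N) rho -
      t i.+1 * (w 0%N * Cj i.+1 (l i.+1) rho + w i.+1 * Sj i.+1 (l i.+1) rho).
      by apply/esym/eqP/yl; lia.
    by rewrite t1; ring.
  (* [det0P] concerns row vectors, hence the transposition. *)
  apply/eqP; rewrite -det_tr; apply/det0P; exists v; last first.
    apply/matrixP => i j; rewrite !mxE -[RHS](Mv j).
    by apply: eq_bigr => k _; rewrite !mxE mulrC.
  apply: contraNneq yx0 => v0.
  have w0 k : (k <= 2 * n)%N -> w k = 0.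
    move=> kn; have := congr1 (fun u : 'rV_ _ => u 0 (inord k)) v0.
    by rewrite !mxE inordK.
  by rewrite (yx _ _ j0n x0l).1 !w0 ?mul0r ?addr0 //; lia.
move/eqP; rewrite -det_tr => /det0P[v v0 vM].
pose w k := v 0 (inord k).
have Mw i : \sum_j M i j * w j = 0.
  have := congr1 (fun u : 'rV_ _ => u 0 i) vM; rewrite !mxE => vi; rewrite -[RHS]vi.
  by apply: eq_bigr => k _; rewrite !mxE /w inord_val mulrC.
have ord_row k (kN : (k < (2 * n).+1)%N) := Mw (Ordinal kN).
exists (fun j x => w 0%N * Cj j x rho + w j * Sj j x rho),
  (fun j x => w 0%N * dCj j x rho + w j * dSj j x rho).
have init j : (1 <= j <= 2 * n)%N ->
    [/\ Cj j 0 rho = 1, Sj j 0 rho = 0, dCj j 0 rho = 0 & dSj j 0 rho = 1].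
  by move=> jn; have [_ _ [-> ->] [-> ->]] := hCS j jn rho.
split.
- by move=> j jn; have [sC sS _ _] := hCS j jn rho; apply: sl_solution_lin.
- have [w00|w00] := eqVneq (w 0%N) 0; last first.
    exists 1%N, 0; split => //; first by rewrite lexx ltW // l0.
    by have [-> -> _ _] := init _ one; rewrite mulr1 mulr0 addr0.
  have [k kn wk] : exists2 k, (1 <= k <= 2 * n)%N & w k != 0.
    apply: contrapT => nw; move/eqP: v0; apply; apply/rowP => i; rewrite mxE.
    rewrite -(inord_val i) -/(w i); apply/eqP; apply: contrapT => /negP wi.
    apply: nw; exists i; last by [].
    apply/andP; split; last by have := ltn_ord i; rewrite ltnS.
    by rewrite lt0n; apply: contraNneq wi => ->; rewrite w00.
  have [x xl Sx] := sine_neq0 rho (l0 k kn) (hCS k kn).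
  by exists k, x; split => //; rewrite w00 mul0r add0r mulf_neq0.
- split=> [j jn|].
    have jn' : (1 <= j <= 2 * n)%N by lia.
    have [-> -> _ _] := init j jn'; have [-> -> _ _] := init _ one.
    by rewrite !mulr0.
  have := ord_row 0%N isT; rewrite bordered_mx_mul //= => row; rewrite -[RHS]row.
  apply: eq_big_nat => j jn; have [_ _ -> ->] := init j jn.
  by rewrite mulr0 mulr1 add0r.
split=> [j jn|].
  have jN : (j.-1 < (2 * n).+1)%N by lia.
  have := ord_row _ jN; rewrite bordered_mx_mul //=.
  have -> : (j.-1 == 0)%N = false by lia.
  have -> : (j.-1 == 2 * n)%N = false by lia.
  have -> : j.-1.+1 = j by lia.
  by move=> row; apply/subr0_eq; rewrite -[RHS]row t1; ring.
have := ord_row (2 * n)%N (ltnSn _); rewrite bordered_mx_mul //= eqxx.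
rewrite eqn0Ngt N0 /= => row; rewrite -[RHS]row mulr_suml -big_split /=.
by apply: eq_big_nat => j jn; ring.
Qed.

End System.

Section EqualEdges.
Context {R : realType}.

Lemma bordered_det_eq0 (K : comPzRingType) N (p g e : nat -> K) (D : K) :
    (2 < N)%N -> (forall i, (1 <= i <= N)%N -> p i = 0) ->
  bordered_det N p g e D = 0.
Proof.
move=> N2 p0.
have prod0 (P : pred nat) i : (1 <= i <= N)%N -> P i ->
    \prod_(1 <= i < N.+1 | P i) p i = 0.
  by move=> iN Pi; rewrite (big_rem i) ?mem_index_iota ?ltnS //= Pi p0 // mul0r.
rewrite /bordered_det big1_seq ?mulr0 ?add0r => [|l _]; last first.
  by case: (eqVneq l 1%N) => [->|l1];
    [apply: (prod0 _ 2%N)|apply: (prod0 _ 1%N)]; lia.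
rewrite big1_seq // => l _; rewrite big1_seq ?mulr0 // => k _.
suff [i iN /andP[il ik]] : exists2 i, (1 <= i <= N)%N & (i != l) && (i != k).
  by rewrite (prod0 _ i) ?il ?ik // mul0r.
case: (eqVneq l 1%N) => [->|l1].
  by case: (eqVneq k 2%N) => [->|k2]; [exists 3%N|exists 2%N]; lia.
case: (eqVneq k 1%N) => [->|k1]; last by exists 1%N; lia.
by case: (eqVneq l 2%N) => [->|l2]; [exists 3%N|exists 2%N]; lia.
Qed.

Lemma Phi_equal_edges n (theta a : nat -> R)
    (Cj dCj Sj dSj : nat -> R -> R[i] -> R[i])
    (rho c s dc ds : R[i]) : (2 <= n)%N ->
    (forall j, (1 <= j <= 2 * n)%N ->
       [/\ Cj j (edge_length n a j) rho = c, Sj j (edge_length n a j) rho = s,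
           dCj j (edge_length n a j) rho = dc
         & dSj j (edge_length n a j) rho = ds]) ->
    c ^+ 2 - dc * s = 1 -> s * (c - ds) = 0 ->
  Phi n theta a Cj dCj Sj dSj rho =
    4 * expi (n%:R * theta_sum n theta) * s ^+ (2 * n - 2) *
    ((cos_sum n theta)%:C ^+ 2 - n%:R ^+ 2 * ds ^+ 2).
Proof.
move=> n2 vals cdc scd; rewrite /Phi; set l := edge_length n a; rewrite -/l in vals.
have n0 : (0 < n)%N by apply: ltnW.
have N0 : (0 < 2 * n)%N by rewrite muln_gt0.
set t := tau n theta; have t1 : t 1%N = 1 by [].
rewrite system_matrixE //; set p := fun i => t i * Sj _ _ _; set g := fun l => _ - _.
set e := fun k => t k * dSj _ _ _; set D := \sum_(_ <= _ < _) _.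
have pE i : (1 <= i <= 2 * n)%N -> p i = t i * s.
  by move=> iN; rewrite /p /=; have [_ -> _ _] := vals i iN.
have [s0|s0] := eqVneq s 0.
  rewrite det_bordered_mx // bordered_det_eq0; [|lia|].
    by rewrite s0 expr0n (_ : (2 * n - 2 == 0)%N = false) ?mulr0 ?mul0r //; lia.
  by move=> i iN; rewrite pE // s0 mulr0.
have cds : c = ds.
  by apply/eqP; rewrite -subr_eq0; move/eqP: scd; rewrite mulf_eq0 (negPf s0).
have t0 i : t i != 0 by exact: tau_neq0.
rewrite det_bordered_mx_field //; last by move=> i iN; rewrite pE // mulf_neq0.
have one : (1 <= 1 <= 2 * n)%N by [].
have gE i : (1 <= i <= 2 * n)%N -> g i = c * (1 - t i).
  move=> iN; rewrite /g /=; have [-> _ _ _] := vals i iN.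
  by have [-> _ _ _] := vals _ one; ring.
have eE i : (1 <= i <= 2 * n)%N -> e i = t i * ds.
  by move=> iN; rewrite /e /=; have [_ _ _ ->] := vals i iN.
have range2 i : (2 <= i < (2 * n).+1)%N -> (1 <= i <= 2 * n)%N by lia.
have from1 (F : nat -> R[i]) : F 1%N = 0 ->
    \sum_(2 <= k < (2 * n).+1) F k = \sum_(1 <= k < (2 * n).+1) F k.
  by move=> F1; rewrite [RHS]big_ltn ?ltnS // F1 add0r.
have DE : D = dc * \sum_(1 <= i < (2 * n).+1) t i.
  rewrite mulr_sumr; apply: eq_big_nat => i iN.
  by have [_ _ -> _] := vals i iN; rewrite mulrC.
have cst1 : \sum_(1 <= i < (2 * n).+1) (1 : R[i]) = 2 * n%:R.
  by rewrite sumr_const_nat subn1 /= natrM.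
have -> : \prod_(1 <= i < (2 * n).+1) p i =
    expi (n%:R * theta_sum n theta) * s ^+ (2 * n).
  have := prodr_const_nat 1 (2 * n).+1 s; rewrite subn1 /= => <-.
  rewrite -prod_tau -big_split; apply: eq_big_nat => i iN.
  exact: pE.
have -> : \sum_(2 <= i < (2 * n).+1) e i * (g i / p i) =
    ds * c / s * (2 * n%:R - \sum_(1 <= i < (2 * n).+1) t i).
  rewrite -cst1 -sumrB mulr_sumr -from1; last by rewrite t1 subrr mulr0.
  apply: eq_big_nat => i /range2 iN; rewrite eE // gE // pE //.
  by field; rewrite ?t0 ?s0.
have -> : \sum_(1 <= i < (2 * n).+1) (p i)^-1 =
    s^-1 * \sum_(1 <= i < (2 * n).+1) (t i)^-1.
  by rewrite mulr_sumr; apply: eq_big_nat => i iN; rewrite pE // invfM mulrC.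
have -> : \sum_(1 <= i < (2 * n).+1) e i / p i = ds / s * (2 * n%:R).
  rewrite -cst1 mulr_sumr; apply: eq_big_nat => i iN; rewrite eE // pE //.
  by field; rewrite ?t0 ?s0.
have -> : \sum_(2 <= i < (2 * n).+1) g i / p i =
    c / s * (\sum_(1 <= i < (2 * n).+1) (t i)^-1 - 2 * n%:R).
  rewrite -cst1 -sumrB mulr_sumr -from1; last by rewrite t1 invr1 subrr mulr0.
  apply: eq_big_nat => i /range2 iN; rewrite gE // pE //.
  by field; rewrite ?t0 ?s0.
rewrite DE /t sum_tau // sum_tauV //.
have -> : s ^+ (2 * n) = s ^+ (2 * n - 2) * s ^+ 2.
  by rewrite -exprD subnK //; lia.
have EV := expiD (theta_sum n theta / 2) (- (theta_sum n theta / 2)).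
rewrite subrr expi0 in EV.
move: EV (expi_neq0 (theta_sum n theta / 2)) => EV E0.
have -> : expi (- (theta_sum n theta / 2)) = (expi (theta_sum n theta / 2))^-1.
  by apply: (mulfI E0); rewrite -EV mulfV.
move: cdc; rewrite -cds => cdc.
have dcE : dc = (c ^+ 2 - 1) / s by rewrite -cdc; field.
by rewrite dcE; field; rewrite E0 s0.
Qed.

End EqualEdges.

Lemma fundamental_solutions_ae_eq (R : realType) (q q' : R -> R) (l : R)
    (C dC S dS C' dC' S' dS' : R -> R[i] -> R[i]) (rho : R[i]) (x : R) :
    potential l q ->
    {ae @lebesgue_measure R, forall x, x \in `]0, l[ -> q' x = q x} ->
    fundamental_solutions q l C dC S dS ->
    fundamental_solutions q' l C' dC' S' dS' -> 0 <= x <= l ->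
  [/\ C x rho = C' x rho, S x rho = S' x rho, dC x rho = dC' x rho
    & dS x rho = dS' x rho].
Proof.
move=> pq qq fCS fCS' xl; have [sC sS [C0 dC0] [S0 dS0]] := fCS' rho.
have [] := sl_solution_expand pq fCS (sl_solution_ae_eq qq sC) xl.
have [] := sl_solution_expand pq fCS (sl_solution_ae_eq qq sS) xl.
rewrite C0 dC0 S0 dS0 => -> -> -> ->.
by rewrite !mul0r !mul1r !add0r !addr0.
Qed.

Theorem theorem3p1 (R : realType) (n : nat) (theta a : nat -> R)
    (qj : nat -> R -> R) (Cj dCj Sj dSj : nat -> R -> R[i] -> R[i])
    (hn : (2 <= n)%N)
    (htheta : forall j, (1 <= j <= n)%N -> - pi <= theta j <= pi)
    (ha : forall j, (1 <= j <= n)%N -> 0 < a j)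
    (hq : forall j, (1 <= j <= 2 * n)%N -> potential (edge_length n a j) (qj j))
    (hCS : forall j, (1 <= j <= 2 * n)%N ->
       fundamental_solutions (qj j) (edge_length n a j)
         (Cj j) (dCj j) (Sj j) (dSj j)) :
  (forall rho : R[i],
     let c j := Cj j (edge_length n a j) rho in
     let s j := Sj j (edge_length n a j) rho in
     let dc j := dCj j (edge_length n a j) rho in
     let ds j := dSj j (edge_length n a j) rho in
     let t := tau n theta in
     Phi n theta a Cj dCj Sj dSj rho =
       - (\sum_(1 <= k < (2 * n).+1) t k * dc k) *
           (\sum_(1 <= l < (2 * n).+1)
              \prod_(1 <= i < (2 * n).+1 | i != l) (t i * s i))
       + \sum_(2 <= l < (2 * n).+1)
           (c 1%N - t l * c l) *
           (\sum_(1 <= k < (2 * n).+1 | k != l)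
              (\prod_(1 <= i < (2 * n).+1 | (i != l) && (i != k)) (t i * s i))
              * (t k * ds k - t l * ds l))) /\
  (forall (len : R) (q : R -> R) (C dC S dS : R -> R[i] -> R[i]),
     (forall j, (1 <= j <= n)%N -> a j = len) ->
     (forall j, (1 <= j <= 2 * n)%N ->
        {ae (@lebesgue_measure R), forall x, x \in `]0, len[ -> qj j x = q x}) ->
     {ae (@lebesgue_measure R), forall x,
        x \in `]0, len[ -> q (len - x) = q x} ->
     fundamental_solutions q len C dC S dS ->
     forall rho : R[i],
     [/\ forall j, (1 <= j <= 2 * n)%N ->
           Cj j (edge_length n a j) rho = C len rho /\
           Sj j (edge_length n a j) rho = S len rho,
         Phi n theta a Cj dCj Sj dSj rho =
           4 * expi (n%:R * theta_sum n theta) * S len rho ^+ (2 * n - 2) *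
           ((cos_sum n theta)%:C ^+ 2 - n%:R ^+ 2 * dS len rho ^+ 2),
         singular_value n theta a Cj dCj Sj dSj rho <->
           [\/ S len rho = 0,
               dS len rho = (n%:R^-1 * cos_sum n theta)%:C |
               dS len rho = - (n%:R^-1 * cos_sum n theta)%:C] &
         has_nontrivial_solution n theta a qj rho <->
           [\/ S len rho = 0,
               dS len rho = (n%:R^-1 * cos_sum n theta)%:C |
               dS len rho = - (n%:R^-1 * cos_sum n theta)%:C]]).
Proof.
have n0 : (0 < n)%N by apply: ltnW.
have N0 : (0 < 2 * n)%N by rewrite muln_gt0.
split=> [rho c s dc ds t|len q C dC S dS alen qjq qeven fCS rho].
  by rewrite /Phi system_matrixE // det_bordered_mx.
have lE j : (1 <= j <= 2 * n)%N -> edge_length n a j = len.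
  by move=> jn; rewrite /edge_length; case: ifP => jn'; apply: alen; lia.
have one : (1 <= 1 <= 2 * n)%N by [].
have len0 : 0 < len by rewrite -(lE _ one) edge_length_gt0.
have ll : 0 <= len <= len by rewrite ltW //= lexx.
have vals j : (1 <= j <= 2 * n)%N ->
    [/\ Cj j (edge_length n a j) rho = C len rho,
        Sj j (edge_length n a j) rho = S len rho,
        dCj j (edge_length n a j) rho = dC len rho
      & dSj j (edge_length n a j) rho = dS len rho].
  move=> jn; have := hq j jn; have := hCS j jn; rewrite lE // => fj pj.
  apply: fundamental_solutions_ae_eq pj _ fj fCS ll.
  by apply: filterS (qjq j jn) => x qx /qx.
have q1even : {ae (@lebesgue_measure R), forall x,
    x \in `]0, len[ -> qj 1%N (len - x) = qj 1%N x}.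
  have q1 := qjq _ one; have q1' := ae_reflect len q1.
  apply: filterS3 q1 q1' qeven => x qx qx' qe xl.
  rewrite qx // qx' ?qe //.
  by move: xl; rewrite !in_itv /= => /andP[? ?]; apply/andP; split; lra.
have [cdc scd] : C len rho ^+ 2 - dC len rho * S len rho = 1 /\
    S len rho * (C len rho - dS len rho) = 0.
  have := hq _ one; have := hCS _ one.
  have [<- <- <- <-] := vals _ one; rewrite lE // => f1 p1.
  exact: (even_boundary_values rho (ltW len0) p1 q1even f1).
have PhiE := Phi_equal_edges theta hn vals cdc scd.
have sing : Phi n theta a Cj dCj Sj dSj rho = 0 <->
    [\/ S len rho = 0, dS len rho = (n%:R^-1 * cos_sum n theta)%:C |
        dS len rho = - (n%:R^-1 * cos_sum n theta)%:C].
  have nC : n%:R != 0 :> R[i] by rewrite pnatr_eq0 -lt0n.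
  have -> : (n%:R^-1 * cos_sum n theta)%:C = n%:R^-1 * (cos_sum n theta)%:C.
    by rewrite rmorphM fmorphV rmorph_nat.
  rewrite PhiE; split.
    move/eqP; rewrite !mulf_eq0 pnatr_eq0 (negPf (expi_neq0 _)) /=.
    rewrite -exprMn subr_sqr mulf_eq0 expf_eq0.
    case/orP => [/andP[_ /eqP S0]|/orP[/eqP h|/eqP h]]; first by apply: Or31.
      by apply: Or32; rewrite (subr0_eq h) mulKf.
    by apply: Or33; rewrite -mulrN (addr0_eq h) mulKf.
  case=> [->|->|->].
  - by rewrite expr0n (_ : (2 * n - 2 == 0)%N = false) ?mulr0
      ?mul0r //; lia.
  - by field.
  - by field.
split=> //; first by move=> j /vals[].
by rewrite -sing; apply: has_nontrivial_solutionP.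
Qed.
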